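(* The identities $u \approx v$ satisfied by the hypoplactic monoid $\mathsf{hypo}$ are exactly the balanced identities such that, for any variables $x,y$ that occur in $u$ and $v$, $u$ admits $xy$ as a subsequence if and only if $v$ does too.
   Context: Let $\mathcal{A} = \{1<2<3<\cdots\}$ be the ordered alphabet of positive integers. For a word $w$, $|w|_a$ is the number of occurrences of the letter $a$; the content $c(w)$ is the tuple $(|w|_a)_a$, and the support $\mathrm{supp}(w)$ is the set of letters occurring in $w$. A quasi-ribbon tableau is a finite grid of cells, aligned so that the leftmost cell in each row is below the rightmost cell of the previous row, filled with letters of $\mathcal{A}$ so that rows weakly increase from left to right and columns strictly increase from top to bottom. Krob--Thibon insertion of a letter $a$ into a quasi-ribbon tableau $T$: if no entry of $T$ is $\le a$, create a new cell $a$ and glue $T$ by its top-leftmost entry to the bottom of this cell; otherwise, let $x$ be the right-most and bottom-most entry of $T$ with $x \le a$, separate $T$ just after $x$, put a new entry $a$ to the right of $x$ and glue the remaining part of $T$ (below and to the right of $x$) onto the bottom of the new entry $a$. For $u \in \mathcal{A}^*$, $\mathrm{P}_{\mathsf{hypo}}(u)$ is the tableau obtained from the empty tableau by inserting the letters of $u$ from left to right. The hypoplactic congruence is: $u \equiv_{\mathsf{hypo}} v$ iff $\mathrm{P}_{\mathsf{hypo}}(u) = \mathrm{P}_{\mathsf{hypo}}(v)$. The hypoplactic monoid is $\mathsf{hypo} = \mathcal{A}^*/{\equiv_{\mathsf{hypo}}}$. Known equivalent description (Novelli): $u \equiv_{\mathsf{hypo}} v$ iff $u$ and $v$ have the same content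 and the same inversions, where, if $\mathrm{supp}(u) = \{a_1<\dots<a_k\}$, $u$ has an $a_{i+1}$-$a_i$ inversion ($1 \le i \le k-1$) iff $a_{i+1}a_i$ is a (scattered) subsequence of $u$. A (monoid) identity over an alphabet of variables $X$ is a formal equality $u \approx v$ with $u,v \in X^*$; it is balanced if $c(u)=c(v)$. A monoid $M$ satisfies $u \approx v$ if $\psi(u) = \psi(v)$ for every monoid homomorphism $\psi: X^* \to M$. A subsequence of $u_1\cdots u_k$ is a word $u_{i_1}\cdots u_{i_m}$ with $i_1 < \cdots < i_m$ (not necessarily contiguous). *)

(* Defs.v *)
From HB Require Import structures.
From mathcomp Require Import all_boot all_order.

Set Implicit Arguments.
Unset Strict Implicit.
Unset Printing Implicit Defensive.

Import Order.TTheory.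
Local Open Scope order_scope.

(* The free monoid X^* is [seq X] under concatenation. *)
HB.instance Definition _ (X : choiceType) :=
  isMonoid.Build (seq X) (@catA X) (@cat0s X) (@cats0 X).

Definition letter := {n : nat | (0 < n)%N}.
HB.instance Definition _ := SubType.on letter.
HB.instance Definition _ := Choice.on letter.
HB.instance Definition _ :=
  [SubChoice_isSubOrder of letter by <: with Order.Disp tt tt].

(* A ribbon shape is determined by its row lengths, so a tableau is encoded by
   its rows, from top to bottom.  Two consecutive rows share exactly one column,
   in which the last cell of the upper row lies just above the first cell of the
   lower row; [column_lt] is the strict increase along that column. *)
Definition column_lt (r s : seq letter) : bool :=
  if (r, s) is (x :: r', y :: _) then last x r' < y else true.

Definition quasi_ribbon (T : seq (seq letter)) : bool :=
  [&& [::] \notin T, all (sorted <=%O) T & sorted column_lt T].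

Record tableau := Tableau { rows : seq (seq letter); _ : quasi_ribbon rows }.
HB.instance Definition _ := [isSub for rows].
HB.instance Definition _ := [Choice of tableau by <:].

(* The entry [x] of the insertion algorithm lies in the last row having an entry
   [<= a].  That row is weakly increasing, so [x] is in position
   [count (<= a) r] of it; what is to the right of [x] becomes a new row starting
   below [a], unless [x] ends its row, in which case the next row does. *)
Fixpoint insert_rows (T : seq (seq letter)) (a : letter) : seq (seq letter) :=
  if T is r :: T' then
    if has (has (fun y => y <= a)) T' then r :: insert_rows T' a
    else if has (fun y => y <= a) r then
      let k := count (fun y => y <= a) r in
      rcons (take k r) a :: (if drop k r is [::] then T' else drop k r :: T')
    else [:: a] :: T
  else [:: [:: a]].

Lemma column_ltE (r s : seq letter) : r != [::] -> s != [::] ->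
  sorted <=%O r -> sorted <=%O s -> column_lt r s = allrel <%O r s.
Proof.
case: r s => [|x r] [|y s] // _ _; rewrite {1}lastI !(sorted_pairwise le_trans).
rewrite pairwise_rcons pairwise_cons => /andP[/allP rl _] /andP[/allP ys _].
apply/idP/allrelP => [lty z t zr ts | ]; last by apply; rewrite ?mem_last ?mem_head.
apply: (le_lt_trans (y := last x r)).
  by move: zr; rewrite lastI mem_rcons inE => /predU1P[->|/rl].
by apply: (lt_le_trans lty); move: ts; rewrite inE => /predU1P[->|/ys].
Qed.

Lemma quasi_ribbon_cons (r : seq letter) (T : seq (seq letter)) :
  quasi_ribbon (r :: T) =
  [&& r != [::], sorted <=%O r, quasi_ribbon T & allrel <%O r (flatten T)].
Proof.
elim: T r => [|s T IHT] r.
  by rewrite /quasi_ribbon /= allrel0r !andbT inE eq_sym.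
have -> : quasi_ribbon [:: r, s & T] =
    [&& r != [::], sorted <=%O r, column_lt r s & quasi_ribbon (s :: T)].
  rewrite /quasi_ribbon /= !inE !(eq_sym [::]) !negb_or.
  move: (r == [::]) (sorted _ r) (column_lt r s) => [] [] [] //=;
    rewrite ?andbT ?andbF //.
rewrite IHT /= allrel_catr; case: (altP (r =P [::])) => //= r0.
case: (altP (s =P [::])) => [|s0] /=; first by rewrite !andbF.
case rS: (sorted _ r) => //=; case sS: (sorted _ s); last by rewrite !andbF.
rewrite (column_ltE r0 s0) //=; case rs: allrel; last by rewrite !andbF.
case: (quasi_ribbon T) => //=; case sT: allrel => //=; apply/esym.
apply/allrelP => x z xr zT; case: s s0 rs sT {sS IHT} => // y s _ /allrelP rs /allrelP sT.
by apply: (lt_trans (rs x y xr (mem_head y s)) (sT y z (mem_head y s) zT)).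
Qed.

Lemma take_count_le (r : seq letter) (a : letter) : sorted <=%O r ->
  take (count (fun y => y <= a) r) r = [seq y <- r | y <= a].
Proof. by move=> rS; rewrite sorted_filter_le. Qed.

Lemma drop_count_le (r : seq letter) (a : letter) : sorted <=%O r ->
  drop (count (fun y => y <= a) r) r = [seq y <- r | a < y].
Proof. by move=> rS; rewrite sorted_filter_gt. Qed.

Lemma insert_rowsP T a : quasi_ribbon T ->
  perm_eq (flatten (insert_rows T a)) (a :: flatten T)
    /\ quasi_ribbon (insert_rows T a).
Proof.
elim: T => //= r T IHT; rewrite quasi_ribbon_cons => /and4P[r0 rS qT rT].
have [eqT qaT] := IHT qT; case: ifPn => [|noT].
  move=> /hasP[s sT /hasP[y ys ya]]; split.
    by apply/permP => p; have /permP/(_ p) := eqT; rewrite /= !count_cat /= => ->; rewrite addnCA.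
  rewrite quasi_ribbon_cons r0 rS qaT; apply/allrelP => x z xr.
  have yT: y \in flatten T by apply/flattenP; exists s.
  rewrite (perm_mem eqT) inE => /predU1P[-> | zT]; last exact: (allrelP rT).
  by apply: lt_le_trans ya; apply: (allrelP rT).
have aT: all (> a) (flatten T).
  apply/allP => y /flattenP[s sT ys]; rewrite ltNge; apply: contra noT => ya.
  by apply/hasP; exists s => //; apply/hasP; exists y.
case: ifPn => [/hasP[x xr xa] | nor].
  rewrite take_count_le // drop_count_le //.
  set f := filter _ r; set g := filter _ r; split.
    have rfg : perm_eq (f ++ g) r.
      rewrite (_ : g = [seq y <- r | predC (fun y => y <= a) y]) ?perm_filterC //.
      by apply: eq_filter => y /=; rewrite ltNge.
    have -> : flatten (rcons f a :: (if g is [::] then T else g :: T)) =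
              f ++ a :: g ++ flatten T by rewrite -cat_rcons; case: (g).
    by rewrite -cat1s perm_catCA /= perm_cons catA perm_cat2r.
  have fS : sorted <=%O (rcons f a).
    rewrite (sorted_pairwise le_trans) pairwise_rcons -(sorted_pairwise le_trans).
    by rewrite filter_all le_sorted_filter.
  have fa x' : x' \in rcons f a -> x' <= a.
    by rewrite mem_rcons inE => /predU1P[-> // |]; rewrite mem_filter => /andP[].
  have f0 : rcons f a != [::] by case: (f).
  have faT : allrel <%O (rcons f a) (flatten T).
    by apply/allrelP => y z /fa ya zT; apply: le_lt_trans ya (allP aT z zT).
  case gE: g => [|y g']; first by rewrite quasi_ribbon_cons f0 fS qT.
  rewrite -gE !quasi_ribbon_cons f0 fS qT {1}gE /= le_sorted_filter //= allrel_catr faT.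
  rewrite andbT; apply/andP; split.
    apply/allrelP => u v; rewrite mem_filter => /andP[_ ur]; exact: (allrelP rT).
  apply/allrelP => u v /fa ua; rewrite mem_filter => /andP[av _].
  exact: le_lt_trans ua av.
split => //; rewrite !quasi_ribbon_cons r0 rS qT rT /=.
rewrite allrel1l all_cat aT andbT; apply/allP => y yr; rewrite ltNge.
by apply: contra nor => ya; apply/hasP; exists y.
Qed.

Lemma flatten_cons (r : seq letter) (T : seq (seq letter)) :
  flatten (r :: T) = r ++ flatten T.
Proof. by []. Qed.

Definition same_row (T : seq (seq letter)) (a b : letter) : bool :=
  has (fun r : seq letter => (a \in r) && (b \in r)) T.

(* [a < b] are neighbours in the support of [s]. *)
Definition consecutive (s : seq letter) (a b : letter) : bool :=
  [&& a \in s, b \in s, a < b & all (fun c => (c <= a) || (b <= c)) s].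

Lemma consecutive_mem s s' : s =i s' -> consecutive s =2 consecutive s'.
Proof.
by move=> ss' a b; rewrite /consecutive !ss' (eq_all_r ss').
Qed.

Lemma same_row_cons (r : seq letter) (T : seq (seq letter)) (a b : letter) :
  same_row (r :: T) a b = (a \in r) && (b \in r) || same_row T a b.
Proof. by []. Qed.

Lemma same_row_mem T a b :
  same_row T a b -> (a \in flatten T) && (b \in flatten T).
Proof.
move=> /hasP[r rT /andP[ar br]].
by apply/andP; split; apply/flattenP; exists r.
Qed.

Lemma same_row_insert T c a b : quasi_ribbon T -> consecutive (c :: flatten T) a b ->
  same_row (insert_rows T c) a b =
  (c != a) && ((c == b) && (c \notin flatten T) || same_row T a b).
Proof.
elim: T => [|r T IHT].
  rewrite /consecutive /= !inE => _ /and4P[/eqP-> /eqP->]; by rewrite ltxx.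
rewrite quasi_ribbon_cons => /and4P[r0 rS qT /allrelP rT] C.
have /and4P[aI bI ab /allP nab] := C; rewrite !inE !flatten_cons !mem_cat in aI bI.
rewrite [insert_rows _ _]/=; case: ifPn => [|noT].
  move=> /hasP[s sT /hasP[y ys yc]].
  have yT : y \in flatten T by apply/flattenP; exists s.
  have rc z : z \in r -> z < c by move=> zr; apply: lt_le_trans yc; apply: rT.
  have cr : c \in r = false by apply/negP => /rc; rewrite ltxx.
  have Tr z : z \in r -> z \in c :: flatten T = false.
    move=> zr; apply/negP; rewrite inE => /predU1P[zc | zT].
      by move: (rc z zr); rewrite zc ltxx.
    by move: (rT z z zr zT); rewrite ltxx.
  have TTr z : z \in r -> z \in flatten T = false.
    by move=> /Tr; rewrite inE => /negbT/norP[_ /negbTE].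
  have cz z : z \in r -> c == z = false.
    by move=> /Tr; rewrite inE eq_sym => /negbT/norP[/negbTE].
  rewrite /= mem_cat cr /=; case br: (b \in r).
    have ar : a \in r.
      have : a \in c :: flatten T = false.
        apply/negP; rewrite inE => /predU1P[ac | aT].
          by have := rc b br; rewrite -ac => /(lt_trans ab); rewrite ltxx.
        by have := lt_trans ab (rT b a br aT); rewrite ltxx.
      by move: aI; rewrite inE orbCA => /orP[| ->].
    by rewrite ar (cz _ ar) (cz _ br).
  rewrite andbF /=; case ar: (a \in r).
    have noS X : a \notin flatten X -> same_row X a b = false.
      by move=> aX; apply/negP => /same_row_mem; rewrite (negbTE aX).
    rewrite !noS ?(perm_mem (insert_rowsP c qT).1) ?(Tr a ar) ?(TTr a ar) //.
    rewrite (cz _ ar) orbF /=; apply/esym/negP => /andP[/eqP cb cT].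
    have /nab/orP[] : y \in c :: flatten (r :: T) by rewrite inE /= mem_cat yT !orbT.
      by rewrite leNgt rT.
    rewrite -cb => cy; have ycE : y = c by apply/le_anti/andP.
    by rewrite -ycE yT in cT.
  apply: IHT => //; move: aI bI; rewrite ar br /= => aI bI.
  apply/and4P; split; rewrite ?inE //; apply/allP => z zI; apply: nab.
  by move: zI; rewrite !inE flatten_cons mem_cat => /orP[->|->]; rewrite ?orbT.
have aT z : z \in flatten T -> c < z.
  move=> /flattenP[s sT zs]; rewrite ltNge; apply: contra noT => zc.
  by apply/hasP; exists s => //; apply/hasP; exists z.
have cT : c \in flatten T = false by apply/negP => /aT; rewrite ltxx.
case: ifPn => [/hasP[x xr xa] | nor]; last first.
  have ar z : z \in r -> c < z.
    by move=> zr; rewrite ltNge; apply: contra nor => zc; apply/hasP; exists z.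
  have cr : c \in r = false by apply/negP => /ar; rewrite ltxx.
  rewrite flatten_cons mem_cat cr cT /= !inE; case: (eqVneq c a) => [ca | ca].
    subst a; rewrite /= cr /=; apply/negP => /orP[/eqP bc|].
      by rewrite bc ltxx in ab.
    by move=> /same_row_mem; rewrite cT.
  rewrite /=; case: eqP => // cb; subst b.
  move: aI; rewrite eq_sym (negbTE ca) /= => /orP[/ar | /aT] /(lt_trans ab); by rewrite ltxx.
rewrite take_count_le // drop_count_le //.
set f := filter _ r; set g := filter _ r.
have -> : same_row (rcons f c :: (if g is [::] then T else g :: T)) a b =
   [|| (a \in rcons f c) && (b \in rcons f c), (a \in g) && (b \in g) | same_row T a b].
  by rewrite /=; case: (g).
rewrite !mem_rcons !inE !mem_filter /= mem_cat cT orbF.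
case: (eqVneq c a) => [ca | ca].
  subst c; rewrite lexx ltxx /= [b == a]gt_eqF // leNgt ab /=.
  by apply/negP => /same_row_mem; rewrite cT.
case: (eqVneq c b) => [cb | cb] /=.
  subst c; rewrite (ltW ab) ltxx /=.
  have ar : a \in r.
    move: aI; rewrite eq_sym (negbTE ca) /= => /orP[// | /aT /(lt_trans ab)].
    by rewrite ltxx.
  by rewrite ar /=; case: (b \in r).
have /nab/orP[lca | lbc] : c \in c :: flatten (r :: T) by rewrite mem_head.
  have {}lca : c < a by rewrite lt_neqAle ca.
  by rewrite lca (lt_trans lca ab) leNgt lca.
have {}lbc : b < c by rewrite lt_neqAle eq_sym cb.
have lac := lt_trans ab lbc.
by rewrite (ltW lac) (ltW lbc) ltNge (ltW lac).
Qed.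

Lemma quasi_ribbon_inj T T' : quasi_ribbon T -> quasi_ribbon T' ->
  flatten T = flatten T' ->
  (forall a b, consecutive (flatten T) a b -> same_row T a b = same_row T' a b) ->
  T = T'.
Proof.
elim: T T' => [|r S IHS] [|r' S'] //.
- by move=> _; rewrite quasi_ribbon_cons; case: r'.
- by rewrite quasi_ribbon_cons; case: r.
have key r1 S1 r2 S2 : quasi_ribbon (r1 :: S1) -> quasi_ribbon (r2 :: S2) ->
    r1 ++ flatten S1 = r2 ++ flatten S2 -> (size r1 < size r2)%N ->
    exists a b, consecutive (r1 ++ flatten S1) a b /\
      same_row (r1 :: S1) a b != same_row (r2 :: S2) a b.
  rewrite quasi_ribbon_cons => /and4P[r10 r1S qS1 /allrelP rS1] _ eqF ltr.
  case: S1 qS1 rS1 eqF => [|[|y s] S1] qS1 rS1 eqF.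
  - by move: ltr; rewrite -(cats0 r1) (eqF : r1 ++ [::] = _) size_cat ltnNge leq_addr.
  - by rewrite quasi_ribbon_cons in qS1.
  case: r1 r10 r1S ltr rS1 eqF => // x0 r1 _ r1S ltr rS1 eqF.
  set x := last x0 r1; have xr : x \in x0 :: r1 by apply: mem_last.
  have yF : y \in flatten ((y :: s) :: S1) by apply: mem_head.
  have xy : x < y by apply: rS1.
  exists x, y; split.
    apply/and4P; split=> //; [by rewrite mem_cat xr | by rewrite mem_cat yF orbT |].
    rewrite all_cat; apply/andP; split.
      move: r1S; rewrite lastI (sorted_pairwise le_trans) pairwise_rcons.
      move=> /andP[/allP rx _]; apply/allP => z.
      by rewrite mem_rcons inE => /predU1P[-> | /rx ->]; rewrite ?lexx.
    move: qS1; rewrite quasi_ribbon_cons => /and4P[_ + _ /allrelP ysS].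
    rewrite (sorted_pairwise le_trans) => /andP[/allP ys _].
    apply/allP => z; rewrite /= inE mem_cat => /or3P[/eqP-> | /ys -> | zS].
    - by rewrite lexx orbT.
    - by rewrite orbT.
    by rewrite (ltW (ysS y z (mem_head _ _) zS)) orbT.
  have -> : same_row [:: x0 :: r1, y :: s & S1] x y = false.
    apply/negP; rewrite same_row_cons => /orP[/andP[_ yr] | /same_row_mem/andP[xF _]].
      by have := rS1 y y yr yF; rewrite ltxx.
    by have := rS1 x x xr xF; rewrite ltxx.
  have r2E : take (size r1).+2 r2 = rcons (x0 :: r1) y.
    rewrite -(takel_cat (flatten S2)) // -eqF take_cat ltnNge leqnSn /=.
    by rewrite -addn1 addKn /= take0 cats1.
  have r2I z : z \in rcons (x0 :: r1) y -> z \in r2 by rewrite -r2E => /mem_take.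
  by rewrite /= !r2I // mem_rcons inE ?eqxx // xr orbT.
move=> qT qT'; move: (qT) (qT'); rewrite !quasi_ribbon_cons.
move=> /and4P[r0 rS qS /allrelP rF] /and4P[r'0 r'S qS' /allrelP r'F] eqF eqR.
have [ltr|gtr|eqr] := ltngtP (size r) (size r').
- have [a [b [C /eqP[]]]] := key _ _ _ _ qT qT' eqF ltr; exact: eqR.
- have [a [b [C /eqP[]]]] := key _ _ _ _ qT' qT (esym eqF) gtr.
  by apply/esym/eqR; rewrite [flatten _]eqF.
have /andP[/eqP rr' /eqP FF'] : (r == r') && (flatten S == flatten S').
  by rewrite -eqseq_cat // -[r' ++ _]eqF.
congr cons => //; apply: IHS => // a b C.
have /and4P[aF bF ab /allP nab] := C.
have aR : a \in r = false by apply/negP => /rF/(_ aF); rewrite ltxx.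
have := eqR a b; rewrite /= -rr' aR /=; apply.
rewrite /consecutive /= !mem_cat aF bF !orbT ab /= all_cat; apply/andP; split; apply/allP => // z.
by move=> /rF/(_ aF)/ltW ->.
Qed.

Lemma quasi_ribbon_insert (T : tableau) a : quasi_ribbon (insert_rows (val T) a).
Proof. by case: (insert_rowsP a (valP T)). Qed.

Definition insert (T : tableau) (a : letter) : tableau :=
  Tableau (quasi_ribbon_insert T a).

Definition empty_tableau : tableau := @Tableau [::] isT.

Definition P_hypo (u : seq letter) : tableau := foldl insert empty_tableau u.

Definition hypo_eq : rel (seq letter) := fun u v => P_hypo u == P_hypo v.

Lemma P_hypo_rcons u c : P_hypo (rcons u c) = insert (P_hypo u) c.
Proof. by rewrite /P_hypo foldl_rcons. Qed.

Lemma perm_P_hypo u : perm_eq (flatten (val (P_hypo u))) u.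
Proof.
elim/last_ind: u => // u c IHu; rewrite P_hypo_rcons.
apply: perm_trans (insert_rowsP c (valP _)).1 _.
by rewrite perm_sym perm_rcons perm_cons perm_sym.
Qed.

Lemma subseq2_cat (T : eqType) (x y : T) s t : subseq [:: x; y] (s ++ t) =
  [|| subseq [:: x; y] s, (x \in s) && (y \in t) | subseq [:: x; y] t].
Proof.
elim: s => //= z s IHs; rewrite inE.
case: eqP => [-> | _] /=; rewrite ?sub1seq ?mem_cat //.
case yt: (y \in t); rewrite ?orbT //= orbF.
rewrite [X in _ || X](_ : _ = false) ?orbF //; apply/negP.
by move=> /mem_subseq/(_ y); rewrite !inE eqxx orbT yt => /(_ isT).
Qed.

Lemma same_row_P_hypo u a b : consecutive u a b ->
  same_row (val (P_hypo u)) a b = ~~ subseq [:: b; a] u.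
Proof.
elim/last_ind: u => // u c IHu.
have eqm : rcons u c =i c :: flatten (val (P_hypo u)).
  by move=> z; rewrite mem_rcons !inE (perm_mem (perm_P_hypo u)).
move=> C; have := C; rewrite (consecutive_mem eqm) P_hypo_rcons => C'.
rewrite (same_row_insert (valP _) C') (perm_mem (perm_P_hypo u)).
have /and4P[aI bI ab nab] := C; rewrite !mem_rcons !inE in aI bI.
have -> : subseq [:: b; a] (rcons u c) = subseq [:: b; a] u || (b \in u) && (c == a).
  by rewrite -cats1 subseq2_cat mem_seq1 /= (eq_sym a); case: (b == c); rewrite orbF.
case: (eqVneq c a) aI bI => [ca _ | ca] /=.
  by rewrite ca (gt_eqF ab) andbT /= => ->; rewrite orbT.
rewrite andbF orbF => au bI.
case cu: (c \in u) => /=.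
  have bu : b \in u by move: bI => /predU1P[-> |].
  rewrite andbF /= IHu // /consecutive au bu ab.
  by move: nab; rewrite all_rcons => /andP[].
rewrite andbT; case: (eqVneq c b) bI => [cb _ | cb /= bu].
  by apply/esym/negP => /mem_subseq/(_ b); rewrite -cb inE eqxx cu => /(_ isT).
rewrite IHu // /consecutive au bu ab.
by move: nab; rewrite all_rcons => /andP[].
Qed.

Lemma flatten_sorted T : quasi_ribbon T -> sorted <=%O (flatten T).
Proof.
rewrite (sorted_pairwise le_trans).
elim: T => // r T IHT; rewrite quasi_ribbon_cons (sorted_pairwise le_trans).
move=> /and4P[_ rS /IHT TS rT]; rewrite /= pairwise_cat rS TS !andbT.
by apply: sub_allrel rT => x y /ltW.
Qed.

(* Novelli's description by content and inversions, from which [hypo_eq] is seen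
   to be a congruence. *)
Lemma hypo_eqP u v : hypo_eq u v <-> perm_eq u v /\
  (forall a b, consecutive u a b -> subseq [:: b; a] u = subseq [:: b; a] v).
Proof.
split=> [/eqP Puv | [uv inv]].
  have uv : perm_eq u v.
    by rewrite -(permPl (perm_P_hypo u)) Puv perm_P_hypo.
  split=> // a b C; apply: negb_inj; rewrite -!same_row_P_hypo ?Puv //.
  by rewrite -(consecutive_mem (perm_mem uv)).
apply/eqP/val_inj/quasi_ribbon_inj; try exact: valP.
  apply: (sorted_eq le_trans le_anti); try exact: flatten_sorted (valP _).
  by rewrite (permPl (perm_P_hypo u)) (permPl uv) perm_sym perm_P_hypo.
move=> a b; rewrite (consecutive_mem (perm_mem (perm_P_hypo u))) => C.
rewrite !same_row_P_hypo ?inv //.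
by rewrite -(consecutive_mem (perm_mem uv)).
Qed.

Lemma hypo_eq_cat u u' v v' :
  hypo_eq u u' -> hypo_eq v v' -> hypo_eq (u ++ v) (u' ++ v').
Proof.
move=> /hypo_eqP[uu' inu] /hypo_eqP[vv' inv]; apply/hypo_eqP; split.
  exact: perm_cat.
move=> a b /and4P[_ _ ab]; rewrite all_cat => /andP[uab vab].
have sub s s' : perm_eq s s' -> all (fun c => (c <= a) || (b <= c)) s ->
    (forall a b, consecutive s a b -> subseq [:: b; a] s = subseq [:: b; a] s') ->
    subseq [:: b; a] s = subseq [:: b; a] s'.
  move=> ss' nab inv'; case as': (a \in s); last first.
    by apply/idP/idP => /mem_subseq/(_ a); rewrite -?(perm_mem ss') as' !inE eqxx orbT => /(_ isT).
  case bs': (b \in s); last first.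
    by apply/idP/idP => /mem_subseq/(_ b); rewrite -?(perm_mem ss') bs' !inE eqxx => /(_ isT).
  by apply: inv'; rewrite /consecutive as' bs' ab.
rewrite !subseq2_cat (sub u u') // (sub v v') //.
by rewrite (perm_mem uu') (perm_mem vv').
Qed.

Lemma hypo_eq_equiv : equiv_class_of hypo_eq.
Proof.
split=> [u | u v | v u w]; rewrite /hypo_eq ?eqxx //.
by move=> /eqP-> /eqP->.
Qed.

Canonical hypo_equiv := EquivRelPack hypo_eq_equiv.

Local Open Scope quotient_scope.

Definition hypo := {eq_quot hypo_eq}.
HB.instance Definition _ := Choice.on hypo.
HB.instance Definition _ := EqQuotient.on hypo.

Definition hypo_mul := lift_op2 hypo (@cat letter).

Lemma pi_hypo_mul : {morph \pi_hypo : u v / u ++ v >-> hypo_mul u v}.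
Proof.
move=> u v; unlock hypo_mul.
by apply/eqmodP; apply: hypo_eq_cat; apply/eqmodP; rewrite reprK.
Qed.

Lemma hypo_mulA : associative hypo_mul.
Proof.
elim/quotW=> u; elim/quotW=> v; elim/quotW=> w.
by rewrite -!pi_hypo_mul catA.
Qed.

Lemma hypo_1mul : left_id (\pi_hypo [::]) hypo_mul.
Proof. by elim/quotW=> u; rewrite -pi_hypo_mul. Qed.

Lemma hypo_mul1 : right_id (\pi_hypo [::]) hypo_mul.
Proof. by elim/quotW=> u; rewrite -pi_hypo_mul cats0. Qed.

HB.instance Definition _ := isMonoid.Build hypo hypo_mulA hypo_1mul hypo_mul1.

Definition satisfies (M : monoidType) (X : choiceType) (u v : seq X) : Prop :=
  forall psi : seq X -> M, monoid_morphism psi -> psi u = psi v.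

Definition content (X : choiceType) (u : seq X) : X -> nat :=
  fun x => count_mem x u.

Definition balanced (X : choiceType) (u v : seq X) : Prop :=
  content u =1 content v.

(* Main.v *)
(** Evaluating variables at words of letters, [u ≈ v] holds in [hypo] iff all
    substitution instances of [u] and [v] have the same content and inversions.
    A two-letter subsequence of a substitution instance comes either from the
    image of a single variable, which only depends on the support, or from a
    two-variable subsequence; this gives sufficiency.  For necessity, substitute
    [2] for [x], [1] for [y] and the empty word for the other variables. *)

Require Import Defs.
From mathcomp Require Import all_boot.

Set Implicit Arguments.
Unset Strict Implicit.
Unset Printing Implicit Defensive.

Local Open Scope quotient_scope.

Lemma subseq2_cons (T : eqType) (x y z : T) s :
  subseq [:: x; y] (z :: s) = (x == z) && (y \in s) || subseq [:: x; y] s.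
Proof. by rewrite -(cat1s z s) subseq2_cat mem_seq1 /=; case: (x == z). Qed.

(** Induction on [s]: the pair lies in the head image, straddles it and a later image, or lies in
    the tail. In the second alternative [x = y] means two occurrences of one variable. *)
Lemma subseq2_flatten_map (X T : eqType) (w : X -> seq T) (s : seq X) (a b : T) :
  subseq [:: a; b] (flatten (map w s)) <->
  (exists2 x, x \in s & subseq [:: a; b] (w x)) \/
  (exists x y, [/\ subseq [:: x; y] s, a \in w x & b \in w y]).
Proof.
elim: s => [|z s IHs]; first by split=> // -[[x] | [x [y []]]].
rewrite [flatten _]/= subseq2_cat; split.
  case/or3P=> [wz | /andP[az /flatten_mapP[y ys by_]] | /IHs].
  - by left; exists z; rewrite ?mem_head.
  - by right; exists z, y; rewrite subseq2_cons eqxx ys.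
  case=> [[x xs wx] | [x [y [xy ax by_]]]].
    by left; exists x; rewrite // inE xs orbT.
  by right; exists x, y; rewrite subseq2_cons xy orbT.
case=> [[x] | [x [y []]]].
  rewrite inE => /predU1P[-> -> // | xs wx]; apply/or3P/Or33/IHs.
  by left; exists x.
rewrite subseq2_cons => /orP[/andP[/eqP-> ys] az by_ | xy ax by_].
  by apply/or3P/Or32; rewrite az; apply/flatten_mapP; exists y.
by apply/or3P/Or33/IHs; right; exists x, y.
Qed.

Lemma subseq2_diag (T : eqType) (x : T) s :
  subseq [:: x; x] s = (1 < count_mem x s)%N.
Proof.
elim: s => // z s IHs; rewrite subseq2_cons IHs /= eq_sym.
case: eqP => _ //=; rewrite add1n ltnS -has_pred1 has_count.
by apply/orb_idr/ltnW.
Qed.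

(** By freeness a morphism to [hypo] is fixed by its values on variables, which lift to words
    through [repr]. *)
Lemma satisfies_hypoP (X : choiceType) (u v : seq X) :
  satisfies hypo u v <->
  forall w : X -> seq letter, hypo_eq (flatten (map w u)) (flatten (map w v)).
Proof.
split=> [uv w | uv psi [psi1 psiM]].
  apply/eqmodP/(uv (fun s => \pi_hypo (flatten (map w s)))).
  by split=> // s t; rewrite map_cat flatten_cat pi_hypo_mul.
pose w x := repr (psi [:: x]).
have psiE s : psi s = \pi_hypo (flatten (map w s)).
  elim: s => [|x s IHs]; first exact: psi1.
  by rewrite (psiM [:: x] s : psi (x :: s) = _) IHs /= pi_hypo_mul reprK.
by rewrite !psiE; apply/eqmodP/uv.
Qed.

Definition letter1 : letter := exist _ 1%N isT.
Definition letter2 : letter := exist _ 2%N isT.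

(** The booleans act as lengths 0 or 1; if [x = y], this variable is sent to the word 21. *)
Definition test_subst (X : eqType) (x y z : X) : seq letter :=
  nseq (z == x) letter2 ++ nseq (z == y) letter1.

Lemma mem_test_subst (X : eqType) (x y z : X) (a : letter) :
  (a \in test_subst x y z) =
  (z == x) && (a == letter2) || (z == y) && (a == letter1).
Proof. by rewrite mem_cat !mem_nseq !lt0b. Qed.

Lemma count_test_subst (X : eqType) (x y : X) s :
  count_mem letter2 (flatten (map (test_subst x y) s)) = count_mem x s.
Proof.
rewrite count_flatten -map_comp -sumn_count; congr sumn; apply: eq_map => z /=.
by rewrite count_cat !count_nseq /= mul1n addn0.
Qed.

(** As [x != y], no single image contains both letters, so an inversion must come from an [x]
    followed by a [y]. *)
Lemma subseq_test_subst (X : eqType) (x y : X) s : x != y ->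
  subseq [:: letter2; letter1] (flatten (map (test_subst x y) s)) =
  subseq [:: x; y] s.
Proof.
move=> xy; apply/idP/idP => [/subseq2_flatten_map | sxy].
  case=> [[z _] | [p [q []]]].
    by rewrite /test_subst; case: eqP => [-> | _]; rewrite ?(negbTE xy) //; case: eqP.
  rewrite !mem_test_subst !andbT !andbF orbF /= => spq /eqP px /eqP qy.
  by rewrite -px -qy.
apply/subseq2_flatten_map; right; exists x, y.
by rewrite !mem_test_subst !eqxx orbT.
Qed.

Lemma consecutive_test_subst (X : eqType) (x y : X) s : x \in s -> y \in s ->
  consecutive (flatten (map (test_subst x y) s)) letter1 letter2.
Proof.
move=> xs ys; apply/and4P; split=> //.
- by apply/flatten_mapP; exists y; rewrite ?mem_test_subst ?eqxx ?orbT.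
- by apply/flatten_mapP; exists x; rewrite ?mem_test_subst ?eqxx.
apply/allP => a /flatten_mapP[z _]; rewrite mem_test_subst.
by case/orP=> /andP[_ /eqP->].
Qed.

Theorem theorem4p1 (X : choiceType) (u v : seq X) :
  satisfies hypo u v <->
  balanced u v /\
  (forall x y : X, x \in u -> x \in v -> y \in u -> y \in v ->
     (subseq [:: x; y] u <-> subseq [:: x; y] v)).
Proof.
split=> [/satisfies_hypoP uv | [bal sub]].
  have bal : balanced u v.
    (* Even with both variables equal to [x], each [x] yields exactly one [letter2]. *)
    move=> x; rewrite /content -!(count_test_subst x x).
    by have /hypo_eqP[/permP->] := uv (test_subst x x).
  split=> // x y xu _ yu _; have [<- | xy] := eqVneq x y.
    (* The word [xx] is a subsequence iff [x] occurs at least twice, which the content decides. *)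
    by have cx : count_mem x u = count_mem x v := bal x; rewrite !subseq2_diag cx.
  have /hypo_eqP[_ inv] := uv (test_subst x y).
  by rewrite -!(subseq_test_subst _ xy) inv // consecutive_test_subst.
have uv : perm_eq u v by apply/allP => x _; apply/eqP/bal.
(* A word admitting [xy] contains both variables, and by equal content so does the other word; hence
   [sub] applies. *)
have suv x y : subseq [:: x; y] u <-> subseq [:: x; y] v.
  split=> s; have m := mem_subseq s; move: (m x) (m y);
    rewrite !inE !eqxx ?orbT => /(_ isT) xs /(_ isT) ys;
    by apply/sub => //; rewrite ?(perm_mem uv) // -(perm_mem uv).
apply/satisfies_hypoP => w; apply/hypo_eqP.
split=> [|a b _]; first exact/perm_flatten/perm_map.
apply/idP/idP => /subseq2_flatten_map H; apply/subseq2_flatten_map.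
  case: H => [[x xu wx] | [x [y [/suv xy ax by_]]]].
    by left; exists x; rewrite -?(perm_mem uv).
  by right; exists x, y.
case: H => [[x xv wx] | [x [y [/suv xy ax by_]]]].
  by left; exists x; rewrite ?(perm_mem uv).
by right; exists x, y.
Qed.
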